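(* (Disjunctive Visser's rules for $\mathsf{iK_d}$) Let $I$ and $J$ be finite sets (possibly empty), $\{m_i\}_{i \in I}$ and $\{n_j\}_{j \in J}$ be sequences of natural numbers, let $A_i,B_i$ ($i\in I$), $C_j,D_j$ ($j\in J$), $E$, $F$ be formulas, and let $$X=\bigwedge_{i \in I} \nabla^{m_i}(A_i \supset B_i) \wedge \bigwedge_{j \in J} \nabla^{n_j} (C_j \rightarrow D_j).$$ If $\mathsf{iK_d} \vdash X \rightarrow (E \vee F)$, then one of the following holds: - $\mathsf{iK_d} \vdash X \rightarrow \nabla^{m_i} A_i$, for some $i \in I$; - $\mathsf{iK_d} \vdash X \rightarrow \nabla^{n_j-1} C_j$, for some $j \in J$ with $n_j \geq 1$; - $\mathsf{iK_d} \vdash X \rightarrow E$; - $\mathsf{iK_d} \vdash X \rightarrow F$.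
   Context: Language and sequents. Fix a set $V$ of atomic propositions. $\mathcal{L}$-formulas (simply ''formulas'') are built from atoms in $V$ and the constants $\top,\bot$ using binary connectives $\wedge,\vee,\supset,\to$ and the unary connective $\nabla$. $\nabla^n A$ is the $n$-fold application of $\nabla$ to $A$, and $\nabla\Gamma=\{\nabla A \mid A\in\Gamma\}$ as a multiset. $\bigwedge$ denotes finite iterated conjunction, with the empty conjunction equal to $\top$. Natural numbers include $0$. A sequent is an expression $\Gamma\Rightarrow\Delta$ with $\Gamma,\Delta$ finite multisets of formulas, $\Delta$ containing at most one formula. Comma is multiset union; a formula stands for its singleton. Calculus $\mathbf{STL(N,H)}$ (over $\mathcal{L}$). Rules are written ''premises / conclusion''; $\Gamma,\Sigma$ are arbitrary finite multisets, $\Delta$ has at most one formula, $A,B$ are arbitrary formulas. Axioms: $(Id)$ $A\Rightarrow A$; $(L\bot)$ $\bot\Rightarrow$; $(R\top)$ $\Rightarrow\top$. $(Lw)$ $\Gamma\Rightarrow\Delta$ / $\Gamma,A\Rightarrow\Delta$. $(Rw)$ $\Gamma\Rightarrow$ / $\Gamma\Rightarrow A$. $(Lc)$ $\Gamma,A,A\Rightarrow\Delta$ / $\Gamma,A\Rightarrow\Delta$. $(cut)$ $\Gamma\Rightarrow A$ and $\Sigma,A\Rightarrow\Delta$ / $\Sigma,\Gamma\Rightarrow\Delta$. $(L\wedge_1)$ $\Gamma,A\Rightarrow\Delta$ / $\Gamma,A\wedge B\Rightarrow\Delta$. $(L\wedge_2)$ $\Gamma,B\Rightarrow\Delta$ /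 $\Gamma,A\wedge B\Rightarrow\Delta$. $(R\wedge)$ $\Gamma\Rightarrow A$ and $\Gamma\Rightarrow B$ / $\Gamma\Rightarrow A\wedge B$. $(L\vee)$ $\Gamma,A\Rightarrow\Delta$ and $\Gamma,B\Rightarrow\Delta$ / $\Gamma,A\vee B\Rightarrow\Delta$. $(R\vee_1)$ $\Gamma\Rightarrow A$ / $\Gamma\Rightarrow A\vee B$. $(R\vee_2)$ $\Gamma\Rightarrow B$ / $\Gamma\Rightarrow A\vee B$. $(N)$ $\Gamma\Rightarrow\Delta$ / $\nabla\Gamma\Rightarrow\nabla\Delta$. $(L\to)$ $\Gamma\Rightarrow A$ and $\Gamma,B\Rightarrow\Delta$ / $\Gamma,\nabla(A\to B)\Rightarrow\Delta$. $(R\to)$ $\nabla\Gamma,A\Rightarrow B$ / $\Gamma\Rightarrow A\to B$. $(L\supset)$ $\Gamma\Rightarrow A$ and $\Gamma,B\Rightarrow\Delta$ / $\Gamma,A\supset B\Rightarrow\Delta$. $(R\supset)$ $\Gamma,A\Rightarrow B$ / $\Gamma\Rightarrow A\supset B$. The logic $\mathsf{iK_d}$ is the set of formulas $A$ such that $\Rightarrow A$ has a proof-tree in $\mathbf{STL(N,H)}$; $\mathsf{iK_d}\vdash A$ means $A\in\mathsf{iK_d}$. *)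

(* Defs.v *)
From Stdlib Require Import Permutation.
From mathcomp Require Import all_boot.
Set Implicit Arguments.
Unset Strict Implicit.
Unset Printing Implicit Defensive.

(* [Imp] is the intuitionistic (Heyting) implication, written with a horseshoe;
   [Arr] is the temporal implication, written with an arrow. *)
Inductive form (V : Type) : Type :=
| Atom of V
| Top
| Bot
| And of form V & form V
| Or of form V & form V
| Imp of form V & form V
| Arr of form V & form V
| Nabla of form V.

Arguments Top {V}.
Arguments Bot {V}.

Declare Scope form_scope.
Delimit Scope form_scope with form.
Bind Scope form_scope with form.
Notation "A ∧ B" := (And A B)
  (at level 80, right associativity) : form_scope.
Notation "A ∨ B" := (Or A B)
  (at level 85, right associativity) : form_scope.
Notation "A ⊃ B" := (Imp A B)
  (at level 90, right associativity) : form_scope.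
Notation "A → B" := (Arr A B)
  (at level 90, B at level 200, right associativity) : form_scope.
Notation "∇ A" := (Nabla A) (at level 35, right associativity) : form_scope.
Notation "∇^( n ) A" := (iter n (@Nabla _) A)
  (at level 35, A at level 35, right associativity) : form_scope.

(* Finite multisets of formulas are lists up to [Permutation], which is what
   [stl_perm] accounts for; "G, A" is [A :: G].  A succedent, having at most one
   formula, is an [option]. *)
Inductive stl (V : Type) : seq (form V) -> option (form V) -> Prop :=
| stl_perm G G' D : Permutation G G' -> stl G D -> stl G' D
| stl_Id A : stl [:: A] (Some A)
| stl_Lbot : stl [:: Bot] None
| stl_Rtop : stl [::] (Some Top)
| stl_Lw G A D : stl G D -> stl (A :: G) D
| stl_Rw G A : stl G None -> stl G (Some A)
| stl_Lc G A D : stl [:: A, A & G] D -> stl (A :: G) D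
| stl_cut G S A D : stl G (Some A) -> stl (A :: S) D -> stl (S ++ G) D
| stl_Land1 G A B D : stl (A :: G) D -> stl ((A ∧ B)%form :: G) D
| stl_Land2 G A B D : stl (B :: G) D -> stl ((A ∧ B)%form :: G) D
| stl_Rand G A B :
    stl G (Some A) -> stl G (Some B) -> stl G (Some (A ∧ B)%form)
| stl_Lor G A B D :
    stl (A :: G) D -> stl (B :: G) D -> stl ((A ∨ B)%form :: G) D
| stl_Ror1 G A B : stl G (Some A) -> stl G (Some (A ∨ B)%form)
| stl_Ror2 G A B : stl G (Some B) -> stl G (Some (A ∨ B)%form)
| stl_N G D : stl G D -> stl (map (@Nabla V) G) (omap (@Nabla V) D)
| stl_Larr G A B D :
    stl G (Some A) -> stl (B :: G) D -> stl ((∇ (A → B))%form :: G) D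
| stl_Rarr G A B :
    stl (A :: map (@Nabla V) G) (Some B) -> stl G (Some (A → B)%form)
| stl_Limp G A B D :
    stl G (Some A) -> stl (B :: G) D -> stl ((A ⊃ B)%form :: G) D
| stl_Rimp G A B : stl (A :: G) (Some B) -> stl G (Some (A ⊃ B)%form).

Definition iKd (V : Type) (A : form V) : Prop := stl [::] (Some A).

(* A nonempty iterated conjunction ends with an extra conjunct [Top], which does
   not change it up to provable equivalence. *)
Definition bigAnd (V : Type) (I : finType) (G : I -> form V) : form V :=
  \big[@And V/Top]_(i : I) G i.

Definition visserX (V : Type) (I J : finType) (m : I -> nat) (n : J -> nat)
    (A B : I -> form V) (C D : J -> form V) : form V :=
  (bigAnd (fun i => ∇^(m i) (A i ⊃ B i)) ∧
   bigAnd (fun j => ∇^(n j) (C j → D j)))%form.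

(* Main.v *)
From Stdlib Require Import Permutation List Classical_Prop.
Require Import Defs.
From mathcomp Require Import all_boot.
Set Implicit Arguments.
Unset Strict Implicit.

(** The proof is an Aczel-style slash argument, carried out along a time line.

    [X → Y] is a theorem exactly when [X] derives [Y] ([iKd_ArrE]), so the claim
    is about consequences of [X].  In a Kripke model of the logic, [∇] is read
    along a monotone map [f]: a point [x] satisfies [∇ A] when [f x] satisfies
    [A], and it satisfies [A → B] when every [y] with [x <= f y] that satisfies
    [A] also satisfies [B].  Take the model of all prime theories and add fresh,
    mutually incomparable points [r 0, r 1, ...] with [f (r k) = r (k + 1)],
    where [r k] is placed below every prime theory containing
    [{A | X derives ∇^k A}].  Then [slash X k A] is what it means for [r k] to
    satisfy [A], with satisfaction above [r k] in the old part of the model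
    replaced by derivability of [∇^k A] from [X].  The truth clause for [A → B]
    at [r (k + 1)] looks back to [r k], and at [r 0] it looks at the old points
    only, because no new point is mapped to [r 0].

    Three facts carry the proof.  Slashed formulas are derivable
    ([slash_derivable]).  Derivable sequents preserve the slash at every time
    ([slash_sound]).  If the first two alternatives of the theorem fail, then
    [X] is slashed at time 0.  Its conjuncts are derivable from it, and the
    implication [A i ⊃ B i] is evaluated at time
    [m i], where its antecedent is not slashed because [∇^(m i) (A i)] is not
    derivable, while [C j → D j] is evaluated at time [n j], where its antecedent
    is tested at time [n j - 1] (or not at all when [n j = 0]).
    Hence if [X] derives [E ∨ F], this disjunction is slashed at time 0, so one
    of [E], [F] is slashed, and therefore derivable. *)

Lemma cut_hypotheses (V : Type) (X : form V) (L : list (form V)) D :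
  Forall (fun A => stl [:: X] (Some A)) L -> stl (L ++ [:: X]) D ->
  stl [:: X] D.
Proof.
elim: L => [|A L IH] //= /Forall_cons_iff [XA XL] dAL.
apply: IH => //; have dLXX := stl_cut XA dAL.
have /stl_Lc dXL : stl [:: X, X & L] D.
  apply: stl_perm dLXX.
  apply: Permutation_trans (Permutation_app_comm _ _) _; apply: perm_skip.
  exact: Permutation_app_comm.
by apply: stl_perm dXL; apply: (Permutation_app_comm [:: X]).
Qed.

Lemma stl_weaken (V : Type) (G : list (form V)) D (S : list (form V)) :
  stl G D -> stl (S ++ G) D.
Proof. by move=> dG; elim: S => [|A S IH] //=; apply: stl_Lw. Qed.

Lemma iterN_shift (V : Type) k (A : form V) :
  iter k (@Nabla V) (Nabla A) = Nabla (iter k (@Nabla V) A).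
Proof. by rewrite -iterSr. Qed.

Lemma stl_iterN (V : Type) k (G : list (form V)) A :
  stl G (Some A) ->
  stl (map (iter k (@Nabla V)) G) (Some (iter k (@Nabla V) A)).
Proof.
by move=> dG; elim: k => [|k /stl_N /=]; rewrite ?map_id // -map_comp.
Qed.

(** The formulas [A] with [∇^k A] derivable from [X] form a theory: rule [stl_N]
    lets any derivation be repeated under [∇^k]. *)
Lemma derivable_closed (V : Type) (X : form V) k (G : list (form V)) A :
  stl G (Some A) ->
  Forall (fun B => stl [:: X] (Some (iter k (@Nabla V) B))) G ->
  stl [:: X] (Some (iter k (@Nabla V) A)).
Proof.
move=> /(stl_iterN k) dG XG.
apply: (@cut_hypotheses _ X (map (iter k (@Nabla V)) G)).
  exact/Forall_map.
apply: (stl_perm _ (stl_weaken [:: X] dG)).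
exact: (Permutation_app_comm [:: X]).
Qed.

Lemma iKd_ArrE (V : Type) (X Y : form V) :
  iKd (X → Y)%form <-> stl [:: X] (Some Y).
Proof.
split=> [/stl_N /= dN | dY]; last exact: stl_Rarr.
have mp : stl [:: Nabla (Arr X Y); X] (Some Y).
  apply: stl_Larr; first exact: stl_Id.
  by apply: (@stl_perm _ [:: X; Y]); [constructor | apply/stl_Lw/stl_Id].
exact: stl_cut dN mp.
Qed.

(** [slash X k A] is forcing of [A] at the fresh point [r k].  Since [r k] is a
    point of a model it never satisfies [Bot], even when [X] derives [Bot]; this
    is also what lets an empty succedent be read as [False]. *)
Fixpoint slash {V : Type} (X : form V) (k : nat) (A : form V) : Prop :=
  match A with
  | Atom _ => stl [:: X] (Some (iter k (@Nabla V) A))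
  | Top => True
  | Bot => False
  | And A1 A2 => slash X k A1 /\ slash X k A2
  | Or A1 A2 => slash X k A1 \/ slash X k A2
  | Imp A1 A2 => stl [:: X] (Some (iter k (@Nabla V) A)) /\
                 (slash X k A1 -> slash X k A2)
  | Arr A1 A2 => stl [:: X] (Some (iter k (@Nabla V) A)) /\
                 (if k is k'.+1 then slash X k' A1 -> slash X k' A2 else True)
  | Nabla A1 => slash X k.+1 A1
  end.

Lemma slash_derivable (V : Type) (X : form V) k (A : form V) :
  slash X k A -> stl [:: X] (Some (iter k (@Nabla V) A)).
Proof.
elim: A k => [v|||A1 IH1 A2 IH2|A1 IH1 A2 IH2|A1 _ A2 _|A1 _ A2 _|A1 IH1] k //=.
- by move=> _; apply: derivable_closed (stl_Rtop V) _.
- case=> /IH1 d1 /IH2 d2.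
  apply: (@derivable_closed _ X k [:: A1; A2]); last first.
    by constructor=> //; constructor.
  apply: stl_Rand; last exact/stl_Lw/stl_Id.
  by apply: (@stl_perm _ [:: A2; A1]); [constructor | apply/stl_Lw/stl_Id].
- case=> [/IH1|/IH2] d.
  + by apply: derivable_closed (stl_Ror1 A2 (stl_Id A1)) _; constructor.
  + by apply: derivable_closed (stl_Ror2 A1 (stl_Id A2)) _; constructor.
- by case.
- by case.
- by move=> /IH1; rewrite iterN_shift.
Qed.

Lemma slash_derivable_closed (V : Type) (X : form V) k (G : list (form V)) A :
  stl G (Some A) -> Forall (slash X k) G ->
  stl [:: X] (Some (iter k (@Nabla V) A)).
Proof.
move=> dG SG; apply: derivable_closed dG _.
by apply: Forall_impl SG => B; apply: slash_derivable.
Qed.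

(** The induction has to treat all times at once: [stl_N] moves from time [k] to
    [k + 1], and the two rules for [→] move between [k + 1] and [k]. *)
Lemma slash_sound (V : Type) (X : form V) (G : list (form V)) D :
  stl G D -> forall k, Forall (slash X k) G ->
  if D is Some A then slash X k A else False.
Proof.
have slashN k L : Forall (slash X k) (map (@Nabla V) L) <->
                  Forall (slash X k.+1) L by exact: Forall_map.
elim=> {G D} [G G' D GG' _ IH|A|||G A D _ IH|G A _ IH|G A D _ IH
  |G S A D _ IHA _ IHD|G A B D _ IH|G A B D _ IH|G A B _ IHA _ IHB
  |G A B D _ IHA _ IHB|G A B _ IH|G A B _ IH|G D _ IH
  |G A B D _ IHA _ IHB|G A B dG IH|G A B D _ IHA _ IHB|G A B dG IH] k.
- by move=> SG'; apply: IH; apply: Permutation_Forall SG'; apply: Permutation_sym.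
- by move=> /Forall_cons_iff [].
- by move=> /Forall_cons_iff [].
- by [].
- by move=> /Forall_cons_iff [_ /IH].
- by move=> /IH.
- by move=> /Forall_cons_iff [SA SG]; apply: IH; constructor=> //; constructor.
- by move=> /Forall_app [SS /IHA SA]; apply: IHD; constructor.
- by move=> /Forall_cons_iff [[SA SB] SG]; apply: IH; constructor.
- by move=> /Forall_cons_iff [[SA SB] SG]; apply: IH; constructor.
- by move=> SG; split; [apply: IHA | apply: IHB].
- by move=> /Forall_cons_iff [[SA|SB] SG]; [apply: IHA | apply: IHB]; constructor.
- by move=> /IH; left.
- by move=> /IH; right.
- by move=> /slashN /IH; case: D {IH}.
- move=> /Forall_cons_iff [[_ SAB] SG].
  by apply: IHB; constructor => //; apply: SAB; apply: IHA.
- move=> SG; split; first exact: slash_derivable_closed (stl_Rarr dG) SG.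
  case: k SG => // k SG SA.
  by apply: IH; constructor => //; apply/slashN.
- move=> /Forall_cons_iff [[_ SAB] SG].
  by apply: IHB; constructor => //; apply: SAB; apply: IHA.
- move=> SG; split; first exact: slash_derivable_closed (stl_Rimp dG) SG.
  by move=> SA; apply: IH; constructor.
Qed.

Lemma slash_iterN (V : Type) (X : form V) k n (A : form V) :
  slash X k (iter n (@Nabla V) A) <-> slash X (n + k) A.
Proof. by elim: n k => [|n IH] k //=; rewrite IH addnS. Qed.

Lemma slash_bigAnd (V : Type) (X : form V) k (I : finType) (G : I -> form V) :
  (forall i, slash X k (G i)) -> slash X k (bigAnd G).
Proof. by move=> SG; apply: (big_ind (slash X k)). Qed.

Lemma bigAnd_elim (V : Type) (I : finType) (G : I -> form V) i :
  stl [:: bigAnd G] (Some (G i)).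
Proof.
rewrite /bigAnd; have: i \in index_enum I by rewrite mem_index_enum.
elim: (index_enum I) => [|j s IH] //; rewrite big_cons inE => /orP[/eqP <-|/IH].
  exact/stl_Land1/stl_Id.
exact: stl_Land2.
Qed.

Theorem theorem12 (V : Type) (I J : finType) (m : I -> nat) (n : J -> nat)
    (A B : I -> form V) (C D : J -> form V) (E F : form V) :
  let X := visserX m n A B C D in
  iKd (X → (E ∨ F))%form ->
  (exists i : I, iKd (X → ∇^(m i) (A i))%form)
  \/ (exists j : J, (1 <= n j)%N /\ iKd (X → ∇^(n j - 1) (C j))%form)
  \/ iKd (X → E)%form
  \/ iKd (X → F)%form.
Proof.
move=> X /iKd_ArrE XEF.
case: (classic (exists i : I, iKd (X → ∇^(m i) (A i))%form)) => [|notA].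
  by left.
case: (classic (exists j : J, (1 <= n j)%N /\ iKd (X → ∇^(n j - 1) (C j))%form))
    => [|notC]; first by right; left.
right; right.
have SX : slash X 0 X.
  split; [apply: slash_bigAnd => i | apply: slash_bigAnd => j];
    apply/slash_iterN; rewrite addn0; split.
  - exact/stl_Land1/(bigAnd_elim (fun i => ∇^(m i) (A i ⊃ B i))%form).
  - move=> /slash_derivable XA; case: notA.
    by exists i; apply/iKd_ArrE.
  - exact/stl_Land2/(bigAnd_elim (fun j => ∇^(n j) (C j → D j))%form).
  - case nj: (n j) => [|k] // /slash_derivable XC; case: notC.
    by exists j; rewrite nj subn1; split=> //; apply/iKd_ArrE.
have : slash X 0 (Or E F) by apply: slash_sound XEF _ _; constructor.
by case=> /slash_derivable XY; [left|right]; apply/iKd_ArrE.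
Qed.
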